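(* For every integer $k\geq 2$, $$\operatorname{spex}_{\kappa}(2k,K_3;k)=k-1.$$ Among the admissible graphs (triangle-free graphs $G$ of order $2k$ with $\kappa(\overline{G})\geq k$), the equality $\rho(G)=k-1$ holds precisely for those containing a $(k-1)$-regular connected component. In particular, $B_{2k,k}=K_{k,k}-M_k$ is extremal, i.e. it is admissible and $\rho(B_{2k,k})=k-1$.
   Context: All graphs are finite, simple and undirected. $\rho(G)$ denotes the largest eigenvalue of the adjacency matrix of $G$, and $\overline{G}$ is the complement of $G$. The vertex-connectivity $\kappa(H)$ is the minimum number of vertices whose deletion disconnects $H$ or leaves a single vertex; in particular $\kappa(K_n)=n-1$. Define $$\operatorname{spex}_{\kappa}(n,K_3;k):=\max\{\rho(G): |V(G)|=n,\ G\text{ is triangle-free},\ \kappa(\overline{G})\geq k\}.$$ $K_{k,k}-M_k$ is the graph obtained from the complete bipartite graph $K_{k,k}$ by deleting the edges of a perfect matching $M_k$ (a matching of size $k$). *)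

(* Defs.v *)
From HB Require Import structures.
From mathcomp Require Import all_boot all_order all_algebra.
From mathcomp Require Import boolp classical_sets reals.
From mathcomp Require complex polyrcf.

Set Implicit Arguments.
Unset Strict Implicit.
Unset Printing Implicit Defensive.

Import Order.TTheory GRing.Theory Num.Theory.

Structure sgraph (n : nat) := SGraph {
  adj : 'I_n -> 'I_n -> bool;
  adj_sym : symmetric adj;
  adj_irrefl : irreflexive adj
}.

Section Graphs.
Variable n : nat.
Implicit Types (G : sgraph n) (A C S : {set 'I_n}) (x y z : 'I_n).

Definition compl_adj G : rel 'I_n := fun x y => (x != y) && ~~ adj G x y.

Lemma compl_adj_sym G : symmetric (compl_adj G).
Proof. by move=> x y; rewrite /compl_adj eq_sym adj_sym. Qed.

Lemma compl_adj_irrefl G : irreflexive (compl_adj G).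
Proof. by move=> x; rewrite /compl_adj eqxx. Qed.

Definition compl_graph G : sgraph n :=
  SGraph (compl_adj_sym G) (compl_adj_irrefl G).

Definition triangle_free G : Prop :=
  forall x y z, ~ [/\ adj G x y, adj G y z & adj G x z].

Definition induced_adj G A : rel 'I_n :=
  fun x y => [&& x \in A, y \in A & adj G x y].

Definition connected_in G A : bool :=
  [forall x in A, forall y in A, connect (induced_adj G A) x y].

(* Deleting every vertex does not count: the empty graph satisfies
   connected_in and has no vertex. *)
Definition separating G S : bool :=
  ~~ connected_in G (~: S) || (#|~: S| == 1).

(* The default value n is irrelevant as soon as 0 < n: deleting all vertices
   but one is then always possible. *)
Definition kappa G : nat := \big[minn/n]_(S | separating G S) #|S|.

Definition components G : {set {set 'I_n}} :=
  equivalence_partition (connect (adj G)) [set: 'I_n].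

Definition regular_on G d C : bool :=
  [forall x in C, #|[set y in C | adj G x y]| == d].

Definition admissible k G : Prop :=
  triangle_free G /\ k <= kappa (compl_graph G).

End Graphs.

(* The parts of K_{k,k} are {0, ..., k-1} and {k, ..., 2k-1}; the perfect
   matching M_k joins i to k + i. *)
Section KkkMinusMatching.
Variable k : nat.
Implicit Types u v : 'I_(2 * k).

Definition Kkk_adj u v : bool := (u < k) != (v < k).

Definition Mk_adj u v : bool :=
  (v == u + k :> nat) || (u == v + k :> nat).

Definition KkkMk_adj : rel 'I_(2 * k) :=
  fun u v => Kkk_adj u v && ~~ Mk_adj u v.

Lemma KkkMk_adj_sym : symmetric KkkMk_adj.
Proof. by move=> u v; rewrite /KkkMk_adj /Kkk_adj /Mk_adj eq_sym orbC. Qed.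

Lemma KkkMk_adj_irrefl : irreflexive KkkMk_adj.
Proof. by move=> u; rewrite /KkkMk_adj /Kkk_adj eqxx. Qed.

Definition KkkMk : sgraph (2 * k) := SGraph KkkMk_adj_sym KkkMk_adj_irrefl.

End KkkMinusMatching.

Local Open Scope ring_scope.

Definition adjmx (R : realType) n (G : sgraph n) : 'M[R]_n :=
  \matrix_(i, j) (adj G i j)%:R.

(* For 0 < n this is a maximum, see rho_max. *)
Definition rho (R : realType) n (G : sgraph n) : R :=
  sup [set a | eigenvalue (adjmx R G) a]%classic.

(* rho takes finitely many values on graphs of order n, so this is a maximum
   whenever some graph of order n is admissible. *)
Definition spex (R : realType) n k : R :=
  sup [set rho R G | G in [set G : sgraph n | admissible k G]]%classic.

Section RealSpectrum.
Import mathcomp.real_closed.complex.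

Lemma adjmx_eigenvalue_ex (R : realType) n (G : sgraph n) :
  (0 < n)%N -> exists a : R, eigenvalue (adjmx R G) a.
Proof.
move=> n0; pose C : numClosedFieldType := R[i]%C.
pose f : {rmorphism R -> C} := real_complex R.
pose A := map_mx f (adjmx R G).
have [z] : exists z, root (char_poly A) z.
  by apply/closed_rootP; rewrite size_char_poly eqSS -lt0n.
rewrite -eigenvalue_root_char => /eigenvalueP[v vA v0].
pose w := (map_mx Num.conj v)^T.
have AT : A^T = A by apply/matrixP => i j; rewrite !mxE adj_sym.
have AC : map_mx Num.conj A = A.
  by apply/matrixP => i j; rewrite !mxE !rmorph_nat.
have Aw : A *m w = z^* *: w.
  by rewrite -{1}AT -trmx_mul -{1}AC -map_mxM vA map_mxZ linearZ.
have vw0 : (v *m w) 0 0 != 0.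
  rewrite mxE psumr_neq0 => [|i _]; last by rewrite !mxE mul_conjC_ge0.
  have [i vi0] : exists i, v 0 i != 0 by apply/rV0Pn.
  by apply/hasP; exists i; rewrite ?mem_index_enum// !mxE mul_conjC_gt0.
have zR : z = z^*.
  apply: (mulIf vw0); move: (mulmxA v A w); rewrite Aw vA.
  by rewrite -scalemxAr -scalemxAl => /matrixP/(_ 0 0); rewrite !mxE.
have /complex_realP[a za] : z \is Num.real by apply/CrealP.
exists a; rewrite eigenvalue_root_char -(fmorph_root f) map_char_poly.
rewrite -eigenvalue_root_char -[f a]za.
by apply/eigenvalueP; exists v.
Qed.

Lemma rho_max (R : realType) n (G : sgraph n) : (0 < n)%N ->
  eigenvalue (adjmx R G) (rho R G) /\
  (forall a, eigenvalue (adjmx R G) a -> a <= rho R G).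
Proof.
move=> n0; set p := char_poly (adjmx R G).
have sE a : (a \in polyrcf.rootsR p) = eigenvalue (adjmx R G) a.
  have p0 : p != 0 by rewrite monic_neq0 ?char_poly_monic.
  by rewrite -(polyrcf.roots_on_rootsR p0) eigenvalue_root_char.
have max_seq (s : seq R) a : a \in s ->
    exists2 m, m \in s & {in s, forall b, b <= m}.
  elim: s a => [//|x [|y s] IHs] a _.
    by exists x => [|b]; rewrite ?mem_head// inE => /eqP->.
  have [m ms mP] := IHs y (mem_head _ _).
  have [xm|/ltW mx] := leP x m; [exists m|exists x].
  - by rewrite inE ms orbT.
  - by move=> b; rewrite inE => /predU1P[->//|/mP].
  - exact: mem_head.
  - by move=> b; rewrite inE => /predU1P[->//|/mP /le_trans]; exact.
have [a0] := adjmx_eigenvalue_ex R G n0; rewrite -sE => /max_seq[m].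
rewrite sE => mE mP.
have ubm : ubound [set a | eigenvalue (adjmx R G) a]%classic m.
  by move=> a /=; rewrite -sE => /mP.
have -> : rho R G = m.
  by apply/le_anti; rewrite ge_sup ?ub_le_sup//; exists m.
by split.
Qed.

End RealSpectrum.

(* Main.v *)
(** Isolating a vertex of the complement by deleting its neighbours shows that
    an admissible graph of order 2k has maximum degree at most k - 1. At a
    coordinate of largest absolute value of an eigenvector, the eigenvalue
    equation gives [rho G <= k - 1]; in case of equality that vertex has degree
    k - 1 and all its neighbours are again coordinates of largest absolute
    value, so that its whole component is (k - 1)-regular. For K_{k,k} - M_k,
    the complement consists of two k-cliques joined by a perfect matching, and
    fewer than k deletions leave some edge of the matching intact, which keeps
    what remains of the cliques connected. *)

Require Import Defs.
From HB Require Import structures.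
From mathcomp Require Import all_boot all_order all_algebra.
From mathcomp Require Import zify.
From mathcomp Require Import boolp classical_sets reals.
Import Order.TTheory GRing.Theory Num.Theory.
Local Open Scope ring_scope.

(** * Degrees, components and vertex-connectivity *)

Section Graph.
Variable n : nat.
Implicit Types (G : sgraph n) (C S : {set 'I_n}) (x y : 'I_n).

Definition deg G x : nat := #|[set y | adj G x y]|.

Lemma connect_adj_sym G : connect_sym (adj G).
Proof. by apply: sym_connect_sym; exact: (@adj_sym _ G). Qed.

Lemma componentsP G C :
  reflect (exists x, C = [set y | connect (adj G) x y]%SET)
          (C \in components G).
Proof.
have E x : [set y in [set: 'I_n]%SET | connect (adj G) x y]%SET
         = [set y | connect (adj G) x y]%SET.
  by apply/setP => y; rewrite !inE.
apply: (iffP imsetP) => [[x _ ->]|[x ->]]; exists x; rewrite ?inE//.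
Qed.

(** A component contains every neighbour of its vertices, so degrees inside it are degrees in
    [G]. *)
Lemma regular_on_componentE G d C : C \in components G ->
  regular_on G d C = [forall x in C, deg G x == d].
Proof.
move=> /componentsP[z ->]; apply: eq_forallb_in => x; rewrite inE => zx.
congr (_ == _); apply: eq_card => y; rewrite !inE andb_idl// => xy.
exact: connect_trans zx (connect1 xy).
Qed.

Lemma kappa_le G S : separating G S -> (kappa G <= #|S|)%N.
Proof.
by move=> sS; rewrite /kappa -minEnat -leEnat; apply: bigmin_le_cond.
Qed.

(** The bound [m <= n] takes care of the default value in the minimum defining [kappa]. *)
Lemma le_kappa G m : (m <= n)%N ->
  (forall S, separating G S -> (m <= #|S|)%N) -> (m <= kappa G)%N.
Proof.
by move=> mn mS; rewrite /kappa -minEnat -leEnat; apply: le_bigmin.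
Qed.

Lemma kappa_le_deg G x : (kappa G <= deg G x)%N.
Proof.
apply: kappa_le; set S := [set y | _]%SET.
have xS : x \in ~: S by rewrite !inE adj_irrefl.
(* Either [x] alone survives, or some other [y] survives and must be cut off from [x]. *)
rewrite /separating orbC; have [//|nS] /= := boolP (#|~: S| == 1)%N.
have [y yS yx] : exists2 y, y \in ~: S & y != x.
  move: nS; rewrite (cardsD1 x) xS eqSS cards_eq0 => /set0Pn[y].
  by rewrite in_setD1 => /andP[]; exists y.
(* The first edge of a path from [x] to [y] would end at a neighbour of [x], hence in the deleted
   set. *)
apply/negP => /forall_inP/(_ x xS)/forall_inP/(_ y yS)/connectP[[|z p]] /=.
  by move=> _ yE; rewrite yE eqxx in yx.
by move=> /andP[/and3P[_ zS xz] _]; rewrite !inE xz in zS.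
Qed.

Lemma deg_compl G x : (deg G x + deg (compl_graph G) x = n.-1)%N.
Proof.
rewrite /deg -cardsUI [X in (_ + X)%N](_ : _ = 0%N) ?addn0.
  rewrite -[in RHS](card_ord n) -(cardsC1 x); apply: eq_card => y.
  rewrite !inE /= /compl_adj eq_sym; case: eqVneq => [->|_] /=.
    by rewrite adj_irrefl.
  exact: orbN.
apply/eqP; rewrite cards_eq0; apply/eqP/setP => y; rewrite !inE /= /compl_adj.
by case: adj; rewrite ?andbF.
Qed.

(** * Eigenvalues against a bound on the degrees *)

Section Spectrum.
Variable R : realType.

Lemma mul_adjmx G (v : 'rV[R]_n) x :
  (v *m adjmx R G) 0 x = \sum_(y in [set y | adj G x y]%SET) v 0 y.
Proof.
rewrite mxE [RHS]big_mkcond; apply: eq_bigr => y _.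
by rewrite mxE inE adj_sym; case: adj; rewrite ?mulr1 ?mulr0.
Qed.

(** The eigenvalue equation at [x] gives [a * |v x| <= sum of |v y| <= deg G x * |v x|], the sum
    being over the neighbours [y] of [x]. If [a = d], both inequalities are equalities. *)
Lemma eigenvector_argmax G (v : 'rV[R]_n) a (d : nat) x :
    v *m adjmx R G = a *: v -> v 0 x != 0 -> (deg G x <= d)%N ->
    (forall y, `|v 0 y| <= `|v 0 x|) ->
  a <= d%:R /\
  (a = d%:R -> deg G x = d /\ forall y, adj G x y -> `|v 0 y| = `|v 0 x|).
Proof.
move=> vA vx dx vmax; have vx0 : 0 < `|v 0 x| by rewrite normr_gt0.
have le_sum : a * `|v 0 x| <= \sum_(y in [set y | adj G x y]%SET) `|v 0 y|.
  apply: le_trans (ler_norm_sum _ _ _); rewrite -mul_adjmx vA mxE normrM.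
  by rewrite ler_wpM2r// ler_norm.
have sum_le : \sum_(y in [set y | adj G x y]%SET) `|v 0 y|
    <= (deg G x)%:R * `|v 0 x|.
  by rewrite mulr_natl -sumr_const; apply: ler_sum.
have ad : a <= (deg G x)%:R by rewrite -(ler_pM2r vx0) (le_trans le_sum).
split=> [|aE]; first by rewrite (le_trans ad)// ler_nat.
have degE : deg G x = d.
  by apply/eqP; rewrite eqn_leq dx -(ler_nat R) -aE.
split=> // y xy; apply/eqP; rewrite eq_le vmax -subr_le0 /=.
(* All terms are nonnegative, so the one at [y] is at most the whole sum. *)
have : \sum_(z in [set z | adj G x z]%SET) (`|v 0 x| - `|v 0 z|) <= 0.
  rewrite sumrB sumr_const subr_le0 -mulr_natl.
  by rewrite -/(deg G x) degE -aE.
apply: le_trans; rewrite (bigD1 y) ?inE//= lerDl.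
by apply: sumr_ge0 => z _; rewrite subr_ge0.
Qed.

Lemma eigenvector_argmax_ex (v : 'rV[R]_n) : v != 0 ->
  exists2 x, v 0 x != 0 & forall y, `|v 0 y| <= `|v 0 x|.
Proof.
move=> /rV0Pn[i vi].
case: (@arg_maxP _ _ _ i predT (fun y => `|v 0 y|)) => // x _ xP.
exists x => [|y]; last exact: xP.
by rewrite -normr_gt0 (lt_le_trans _ (xP i isT))// normr_gt0.
Qed.

Lemma eigenvalue_le_deg G a (d : nat) : (forall x, (deg G x <= d)%N) ->
  eigenvalue (adjmx R G) a -> a <= d%:R.
Proof.
move=> dG /eigenvalueP[v vA /eigenvector_argmax_ex[x vx xP]].
by have [] := eigenvector_argmax _ _ _ _ _ vA vx (dG x) xP.
Qed.

Lemma regular_component_of_eigenvalue G (d : nat) :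
    (forall x, (deg G x <= d)%N) -> eigenvalue (adjmx R G) d%:R ->
  exists2 C, C \in components G & regular_on G d C.
Proof.
move=> dG /eigenvalueP[v vA /eigenvector_argmax_ex[x vx xP]].
have CG : [set y | connect (adj G) x y]%SET \in components G.
  by apply/componentsP; exists x.
exists [set y | connect (adj G) x y]%SET => //.
rewrite regular_on_componentE//; apply/forall_inP => y; rewrite inE => xy.
(* The equality case applies at every vertex of [M]; hence [M] is closed under adjacency and
   contains the component of [x]. *)
pose M := [pred z | `|v 0 z| == `|v 0 x|].
have step z : z \in M -> deg G z = d /\ forall t, adj G z t -> t \in M.
  rewrite inE => /eqP zE.
  have vz : v 0 z != 0 by rewrite -normr_eq0 zE normr_eq0.
  have zP t : `|v 0 t| <= `|v 0 z| by rewrite zE.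
  have [_ /(_ erefl)[dz zt]] := eigenvector_argmax _ _ _ _ _ vA vz (dG z) zP.
  by split=> // t /zt; rewrite inE zE => ->.
have closedM : closed (adj G) M.
  by apply: intro_closed; [exact: connect_adj_sym|move=> z t zt /step[_]; exact].
have /step[->] // : y \in M by rewrite -(closed_connect closedM xy) inE.
Qed.

(** The indicator vector of [C] is an eigenvector: a vertex of [C] has its [d] neighbours in [C],
    and any other vertex has none there. *)
Lemma eigenvalue_of_regular_component G (d : nat) C :
  C \in components G -> regular_on G d C -> eigenvalue (adjmx R G) d%:R.
Proof.
move=> CG; rewrite regular_on_componentE//.
have /componentsP[x CE] := CG; move=> /forall_inP reg.
apply/eigenvalueP; exists (\row_y (y \in C)%:R); last first.
  by apply/rV0Pn; exists x; rewrite mxE CE inE connect0 oner_eq0.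
apply/rowP => y; rewrite mul_adjmx !mxE.
have inC z : z \in [set z | adj G y z]%SET -> (z \in C) = (y \in C).
  rewrite inE CE !inE => yz.
  by rewrite (same_connect_r (connect_adj_sym G) (connect1 yz)).
under eq_bigr => z /inC zC do rewrite mxE zC.
rewrite sumr_const; have [/reg/eqP<-|_] := boolP (y \in C).
  by rewrite mulr1.
by rewrite mul0rn mulr0.
Qed.

Lemma rho_le_deg G (d : nat) : (0 < n)%N -> (forall x, (deg G x <= d)%N) ->
  rho R G <= d%:R.
Proof.
by move=> n0 dG; have [rE _] := rho_max R G n0; apply: eigenvalue_le_deg rE.
Qed.

Lemma rho_eq_degP G (d : nat) : (0 < n)%N -> (forall x, (deg G x <= d)%N) ->
  rho R G = d%:R <-> exists2 C, C \in components G & regular_on G d C.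
Proof.
move=> n0 dG; have [rE rP] := rho_max R G n0; split=> [rd|[C CG Creg]].
  by apply: regular_component_of_eigenvalue; rewrite -?rd.
apply/le_anti; rewrite rho_le_deg//= rP//.
exact: eigenvalue_of_regular_component Creg.
Qed.

End Spectrum.
End Graph.

Arguments deg {n} G x.

(** * The graph K_{k,k} - M_k and the degrees of admissible graphs *)

Section KkkMk.
Variable k : nat.
Implicit Types (b c : bool) (i j : 'I_k) (u v w : 'I_(2 * k)).

Lemma part_subproof b i : (i + b * k < 2 * k)%N.
Proof. by have := ltn_ord i; case: b; lia. Qed.

(** Vertices are given coordinates: the side [b] and the index [i] of the matching edge, which joins
    [part false i] to [part true i]. *)
Definition part b i : 'I_(2 * k) := Ordinal (part_subproof b i).

Lemma pair_of_subproof u : (u %% k < k)%N.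
Proof. by rewrite ltn_mod; have := ltn_ord u; lia. Qed.

Definition pair_of u : 'I_k := Ordinal (pair_of_subproof u).

Lemma partK b : cancel (part b) pair_of.
Proof. by move=> i; apply/val_inj; rewrite /= addnC modnMDl modn_small. Qed.

Lemma part_pair_of u : u = part (k <= u)%N (pair_of u).
Proof.
apply/val_inj => /=; have [uk|ku] := ltnP u k.
  by rewrite modn_small// addn0.
have uk : (u - k < k)%N by have := ltn_ord u; lia.
by rewrite -{2}(subnK ku) modnDr modn_small// mul1n subnK.
Qed.

Variant part_spec : 'I_(2 * k) -> Type := PartSpec b i : part_spec (part b i).

Lemma partP u : part_spec u.
Proof. by rewrite (part_pair_of u). Qed.

Lemma adj_part b i c j :
  adj (KkkMk k) (part b i) (part c j) = (b != c) && (i != j).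
Proof.
rewrite /= /KkkMk_adj /Kkk_adj /Mk_adj /= -!val_eqE /=.
by have := ltn_ord i; have := ltn_ord j; case: b; case: c; lia.
Qed.

(** The exclusive or covers both kinds of edges: inside a clique only the sides agree, along the
    matching only the indices do. *)
Lemma compl_adj_part b i c j :
  compl_adj (KkkMk k) (part b i) (part c j) = (b == c) (+) (i == j).
Proof.
rewrite /compl_adj adj_part; have [<-|ij] := eqVneq i j.
  rewrite andbF andbT addbT; congr (~~ _); apply/eqP/eqP => [/(congr1 val)/=|->//].
  by have := ltn_ord i; case: b; case: c; lia.
rewrite andbT negbK addbF andb_idl// => _; apply: contra_neq ij.
by move=> /(congr1 pair_of); rewrite !partK.
Qed.

Lemma deg_KkkMk u : deg (KkkMk k) u = (k - 1)%N.
Proof.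
case: (partP u) => b i; rewrite subn1 -[in RHS](card_ord k) -(cardsC1 i).
(* The neighbours of [part b i] are the [part (~~ b) j] with [j] different from [i]. *)
rewrite -(card_imset _ (can_inj (partK (~~ b)))) /deg; apply: eq_card => v.
rewrite inE; case: (partP v) => c j; rewrite adj_part.
apply/andP/imsetP => [[bc ij]|[j' + E]].
  by exists j; [rewrite !inE eq_sym|case: b c bc => -[]].
rewrite !inE => j'i; apply/andP.
by rewrite -adj_part E adj_part (eq_sym i) j'i; case: b {E}.
Qed.

Lemma triangle_free_KkkMk : triangle_free (KkkMk k).
Proof.
move=> u v w; case: (partP u) => b i; case: (partP v) => c j.
case: (partP w) => d l; rewrite !adj_part => -[/andP[+ _] /andP[+ _] /andP[+ _]].
by case: b; case: c; case: d.
Qed.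

Lemma connected_compl_KkkMk (S : {set 'I_(2 * k)}) : (#|S| < k)%N ->
  connected_in (compl_graph (KkkMk k)) (~: S).
Proof.
(* By pigeonhole, some matching edge has neither endpoint in [S]. *)
move=> Sk; have [i iS] : exists i, i \notin pair_of @: S.
  apply/existsP; rewrite -negb_forall; apply/negP => /forallP iS.
  suff : (k <= #|pair_of @: S|)%N by rewrite leqNgt (leq_ltn_trans (leq_imset_card _ _) Sk).
  by rewrite -[X in (X <= _)%N]card_ord; apply/subset_leq_card/fintype.subsetP.
have iSb b : part b i \in ~: S.
  by rewrite inE; apply: contra iS => /(imset_f pair_of); rewrite partK.
pose e := induced_adj (compl_graph (KkkMk k)) (~: S).
have esym : connect_sym e.
  by apply: sym_connect_sym => u v; rewrite /e /induced_adj adj_sym andbCA.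
(* Move inside the clique of [u] to [part b i], then cross the surviving matching edge if [b] is
   true. *)
have base u : u \in ~: S -> connect e u (part false i).
  case: (partP u) => b j uS.
  have bb : connect e (part b j) (part b i).
    have [->//|ij] := eqVneq j i; apply: connect1.
    by rewrite /e /induced_adj uS iSb /= compl_adj_part eqxx (negPf ij).
  apply: connect_trans bb _; case: b {uS} => //; apply: connect1.
  by rewrite /e /induced_adj !iSb /= compl_adj_part eqxx.
apply/forall_inP => u uS; apply/forall_inP => v vS.
by apply: connect_trans (base u uS) _; rewrite esym; exact: base.
Qed.

Lemma admissible_KkkMk : (2 <= k)%N -> admissible k (KkkMk k).
Proof.
move=> k2; split; first exact: triangle_free_KkkMk.
apply: le_kappa => [|S]; first by lia.
rewrite leqNgt /separating; apply: contraL => Sk.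
rewrite connected_compl_KkkMk//=.
(* A single survivor would mean [2k - 1] deletions, which is not below [k]. *)
apply/negP => /eqP S1; have := cardsC S; rewrite S1 card_ord => Sn.
by move: Sk; rewrite -(ltn_add2r 1) Sn; lia.
Qed.

(** The degree of [u] in the complement is at least [k], and the two degrees sum to [2k - 1]. *)
Lemma admissible_deg (G : sgraph (2 * k)) u :
  admissible k G -> (deg G u <= k - 1)%N.
Proof.
move=> [_ kG]; have := leq_trans kG (kappa_le_deg _ _ u).
by have := deg_compl _ G u; lia.
Qed.

End KkkMk.

Theorem proposition4p4 (R : realType) (k : nat) (hk : (2 <= k)%N) :
  [/\ spex R (2 * k)%N k = k%:R - 1,
      (forall G : sgraph (2 * k)%N, admissible k G ->
         (rho R G = k%:R - 1 <->
          exists2 C, C \in components G & regular_on G (k - 1)%N C)),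
      admissible k (KkkMk k)
    & rho R (KkkMk k) = k%:R - 1].
Proof.
have n0 : (0 < 2 * k)%N by lia.
have -> : k%:R - 1 = (k - 1)%:R :> R by rewrite natrB//; lia.
have admB := admissible_KkkMk _ hk.
have rhoB : rho R (KkkMk k) = (k - 1)%:R.
  apply/rho_eq_degP => // [u|]; first by rewrite deg_KkkMk.
  (* The whole graph is [(k - 1)]-regular, so the component of any vertex will do. *)
  pose C := [set y | connect (adj (KkkMk k)) (Ordinal n0) y]%SET.
  have CB : C \in components (KkkMk k) by apply/componentsP; exists (Ordinal n0).
  exists C => //; rewrite regular_on_componentE//.
  by apply/forall_inP => u _; rewrite deg_KkkMk.
have degG (G : sgraph (2 * k)) (aG : admissible k G) u := admissible_deg _ G u aG.
split=> // [|G aG]; last by apply: rho_eq_degP => // u; exact: degG.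
have ub : ubound [set rho R G | G in [set G : sgraph (2 * k) | admissible k G]]%classic
    (k - 1)%:R.
  by move=> _ [G aG <-]; apply: rho_le_deg => // u; exact: degG.
apply/le_anti/andP; split.
  by apply: ge_sup => //; exists (rho R (KkkMk k)); exists (KkkMk k).
by apply: ub_le_sup; [exists (k - 1)%:R|exists (KkkMk k)].
Qed.
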